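(* Let $n\geq 1$, and let $B=(b_{r-s})_{r,s=0}^n$ be a real symmetric positive-definite Toeplitz matrix, with $b_{-j}=b_j$. Define $$S_k(B)=\sum_{\substack{0\leq r,s\leq n\\ |r-s|=k}}\det B^{(r,s)},\quad 0\leq k\leq n,$$ where $B^{(r,s)}$ is obtained from $B$ by deleting row $r$ and column $s$. The following statements are equivalent: (i) $S_k(B)\geq 0$ for every $0\leq k\leq n$. (ii) Every real symmetric positive-definite Toeplitz matrix $A=(a_{r-s})_{r,s=0}^n$, with $a_{-j}=a_j$, satisfying $$(-1)^j(b_j-a_j)\geq 0,\quad 0\leq j\leq n,$$ satisfies $\det A\leq\det B$. Whenever these conditions hold, for $A$ as in (ii) equality $\det A=\det B$ occurs if and only if $A=B$. The condition $S_0(B)>0$ is automatic (it holds for every such $B$). In particular, (i) holds if all unsigned deleted minors $\det B^{(r,s)}$, $0\leq r,s\leq n$, are non-negative, and hence whenever $B$ is totally non-negative.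
   Context: Row and column indices of matrices start at $0$. A matrix is totally non-negative if every one of its minors is non-negative. An unsigned deleted minor of $B$ is a determinant $\det B^{(r,s)}$ (without the cofactor sign $(-1)^{r+s}$). *)

(* Defs.v *)
From mathcomp Require Import all_boot all_order all_algebra.
From mathcomp Require Import reals.

Set Implicit Arguments.
Unset Strict Implicit.
Unset Printing Implicit Defensive.

Import Order.TTheory GRing.Theory Num.Theory.
Local Open Scope ring_scope.

(* Only the values of [b] on [-n, n] matter; the matrix has order n + 1. *)
Definition toeplitz (R : realType) (n : nat) (b : int -> R) : 'M[R]_n.+1 :=
  \matrix_(r, s) b (r%:Z - s%:Z).

Definition even_seq (R : realType) (b : int -> R) : Prop :=
  forall j : int, b (- j) = b j.

Definition posdef (R : realType) (m : nat) (A : 'M[R]_m) : Prop :=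
  A^T = A /\ forall v : 'cV[R]_m, v != 0 -> 0 < (v^T *m A *m v) 0 0.

(* Unlike MathComp's [cofactor], this carries no sign (-1)^(r+s). *)
Definition deleted_minor (R : realType) (m : nat) (B : 'M[R]_m) (r s : 'I_m) : R :=
  \det (row' r (col' s B)).

Definition deleted_minor_sum (R : realType) (n : nat) (B : 'M[R]_n.+1) (k : nat) : R :=
  \sum_(r < n.+1) \sum_(s < n.+1 | `|r%:Z - s%:Z|%N == k) deleted_minor B r s.

Definition totally_nonneg (R : realType) (m : nat) (B : 'M[R]_m) : Prop :=
  forall (k : nat) (f g : 'I_k -> 'I_m),
    {homo f : i j / (i < j)%N} -> {homo g : i j / (i < j)%N} ->
    0 <= \det (mxsub f g B).

Definition alternating_le (R : realType) (n : nat) (a b : int -> R) : Prop :=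
  forall j : nat, (j <= n)%N -> 0 <= (-1) ^+ j * (b j%:Z - a j%:Z).

(* Main.v *)
Require Import Defs.
From mathcomp Require Import all_boot all_order all_algebra.
From mathcomp Require Import reals zify ring lra.

(** The function log det is strictly concave on positive-definite matrices, so
    its graph lies strictly below its tangent at B:
    log det A <= log det B + tr (B^-1 (A - B)), with equality only at A = B.
    Hence tr (adj B (A - B)) <= 0 forces det A <= det B, with equality exactly
    when A = B ([det_leif]).  To prove the latter, let a congruence turn B into
    the identity ([posdef_diagonalize]) and A into a matrix C; the trace
    condition becomes tr C <= m, where m is the order of the matrices, and
    Hadamard's inequality ([hadamard]) together with the arithmetic-geometric
    mean inequality, each with its equality case, gives det C <= 1 ([det_le1]).

    For Toeplitz matrices the trace is explicit ([tr_adj_toeplitz]): the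
    cofactor sign (-1)^(r+s) depends only on |r - s|, so that
    tr (adj B (A - B)) is the sum over k of (-1)^k (a_k - b_k) S_k(B).  The
    alternating hypothesis on A makes each term nonpositive as soon as all the
    S_k(B) are nonnegative, which gives (i) -> (ii) and the equality case.

    Conversely, if S_k(B) < 0, moving only the k-th diagonals of B, in the
    direction allowed by the alternating hypothesis, starts with a positive
    derivative of the determinant, so a small step yields an admissible matrix
    of larger determinant ([det_increase]).  Indeed, writing E for the
    direction, tr (adj B E) = - S_k(B) is positive, so by continuity
    tr (adj A E) is still positive at a nearby matrix A = B + t E, and the
    tangent inequality based at A, applied to B, gives det B < det A.

    Finally S_0 is the sum of the diagonal cofactors, which are positive
    because the inverse of B is again positive definite. *)

Set Implicit Arguments.
Unset Strict Implicit.
Unset Printing Implicit Defensive.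

Import Order.TTheory GRing.Theory Num.Theory.
Local Open Scope ring_scope.

(** * Positive-definite matrices and Schur complements *)

Lemma posdef_congr (R : realType) (m : nat) (A P : 'M[R]_m) :
  posdef A -> P \in unitmx -> posdef (P^T *m A *m P).
Proof.
move=> [symA posA] uP; split; first by rewrite !trmx_mul symA trmxK mulmxA.
move=> v v_neq0; have Pv_neq0 : P *m v != 0.
  by apply: contraNneq v_neq0 => Pv0; rewrite -(mulKmx uP v) Pv0 mulmx0.
by have := posA _ Pv_neq0; rewrite trmx_mul !mulmxA.
Qed.

Lemma posdef_drsub (R : realType) (m1 m2 : nat) (a : 'M[R]_m1)
    (u : 'M[R]_(m1, m2)) (v : 'M[R]_(m2, m1)) (d : 'M[R]_m2) :
  posdef (block_mx a u v d) -> posdef d.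
Proof.
move=> [symA posA]; split.
  by move: symA; rewrite tr_block_mx => /eq_block_mx[].
move=> x x_neq0; have := posA (col_mx 0 x).
rewrite tr_col_mx trmx0 mul_row_block mul_row_col !(mul0mx, mulmx0, add0r).
by apply; apply: contraNneq x_neq0 => /colP x0; apply/eqP/colP => i;
  have := x0 (rshift m1 i); rewrite col_mxEd !mxE.
Qed.

Lemma posdef_diag_gt0 (R : realType) (m : nat) (A : 'M[R]_m) i :
  posdef A -> 0 < A i i.
Proof.
move=> [_ posA]; have := posA (delta_mx i 0).
rewrite trmx_delta -rowE -colE !mxE; apply.
by apply/eqP => /matrixP/(_ i 0); rewrite !mxE !eqxx; apply/eqP/oner_neq0.
Qed.

(** Right multiplication by this unipotent matrix clears the first row of a
    matrix with corner c and first row (c, u); on a symmetric matrix, the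
    congruence that it defines clears the first column as well. *)
Definition pivot_mx (R : realType) (m : nat) (c : R) (u : 'rV[R]_m) : 'M_(1 + m) :=
  block_mx 1%:M (- c^-1 *: u) 0 1%:M.

Definition schur (R : realType) (m : nat) (c : R) (u : 'rV[R]_m) (d : 'M[R]_m) :=
  d - c^-1 *: (u^T *m u).

Lemma det_pivot (R : realType) (m : nat) (c : R) (u : 'rV[R]_m) :
  \det (pivot_mx c u) = 1.
Proof. by rewrite det_ublock !det1 mulr1. Qed.

Lemma unit_pivot (R : realType) (m : nat) (c : R) (u : 'rV[R]_m) :
  pivot_mx c u \in unitmx.
Proof. by rewrite unitmxE det_pivot unitr1. Qed.

Lemma pivot_congr (R : realType) (m : nat) (c : R) (u : 'rV[R]_m) (d : 'M[R]_m) :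
  c != 0 ->
  (pivot_mx c u)^T *m block_mx c%:M u u^T d *m pivot_mx c u =
  block_mx c%:M 0 0 (schur c u d).
Proof.
move=> c0; rewrite /pivot_mx /schur tr_block_mx !trmx1 !trmx0 !mulmx_block.
rewrite !(mul1mx, mulmx1, mul0mx, mulmx0, addr0, add0r).
rewrite !linearZ /= -!scalemxAl mul_mx_scalar mul_scalar_mx !scalerA mulNr.
rewrite mulVf // !scaleN1r !addNr mul0mx scaler0 add0r scaleNr.
by rewrite scalerN addrC.
Qed.

(** This is the induction step for the results below: it peels off one
    pivot c > 0 and leaves a positive-definite matrix of order one less. *)
Lemma posdef_schur (R : realType) (m : nat) (A : 'M[R]_(1 + m)) :
  posdef A -> exists c u d,
    [/\ A = block_mx c%:M u u^T d, 0 < c & posdef (schur c u d)].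
Proof.
move=> pdA; have [symA _] := pdA.
have defA : A = block_mx (A 0 0)%:M (ursubmx A) (ursubmx A)^T (drsubmx A).
  rewrite -{1}[A]submxK; congr block_mx.
    by rewrite [LHS]mx11_scalar !mxE !lshift0.
  by rewrite trmx_ursub symA.
have c_gt0 : 0 < A 0 0 by exact: posdef_diag_gt0.
move: (A 0 0) (ursubmx A) (drsubmx A) defA c_gt0 => c u d defA c_gt0.
exists c, u, d; split=> //; have := posdef_congr pdA (unit_pivot c u).
by rewrite defA pivot_congr ?gt_eqF // => /posdef_drsub.
Qed.

(** A Cholesky decomposition written as a congruence: each pivot is
    normalised by its square root, and the induction treats the Schur
    complement. *)
Lemma posdef_diagonalize (R : realType) (m : nat) (A : 'M[R]_m) :
  posdef A -> exists2 P : 'M[R]_m, P \in unitmx & P^T *m A *m P = 1%:M.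
Proof.
elim: m A => [|m IH] A pdA.
  by exists 1%:M; rewrite ?unitmx1 //; apply/matrixP => [[]].
have [c [u [d [-> c_gt0 /IH[Q uQ defQ]]]]] := posdef_schur pdA.
pose D : 'M_(1 + m) := block_mx (Num.sqrt c)^-1%:M 0 0 Q.
have sc_neq0 : Num.sqrt c != 0 by rewrite gt_eqF // sqrtr_gt0.
have uD : D \in unitmx.
  by rewrite block_diag_mx_unit uQ andbT unitmxE det_scalar1 unitrV unitfE.
have defD : D^T *m block_mx c%:M 0 0 (schur c u d) *m D = 1%:M.
  rewrite tr_block_mx !trmx0 tr_scalar_mx !mulmx_block.
  rewrite !(mul0mx, mulmx0, addr0, add0r) defQ -!scalar_mxM.
  rewrite -{2}(sqr_sqrtr (ltW c_gt0)) expr2 mulKf // divff //.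
  by rewrite -scalar_mx_block.
exists (pivot_mx c u *m D); first by rewrite unitmx_mul unit_pivot.
rewrite trmx_mul !mulmxA -(mulmxA D^T) -(mulmxA D^T) pivot_congr ?gt_eqF //.
Qed.

Lemma det_pivot_congr (R : realType) (m : nat) (c : R) (u : 'rV[R]_m) d :
  c != 0 -> \det (block_mx c%:M u u^T d) = c * \det (schur c u d).
Proof.
move=> c0; have := pivot_congr u d c0 => /(congr1 determinant).
by rewrite !det_mulmx det_tr det_pivot mul1r mulr1 det_ublock det_scalar1.
Qed.

Lemma posdef_det_gt0 (R : realType) (m : nat) (A : 'M[R]_m) :
  posdef A -> 0 < \det A.
Proof.
elim: m A => [|m IH] A pdA; first by rewrite det_mx00.
have [c [u [d [-> c_gt0 /IH d_gt0]]]] := posdef_schur pdA.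
by rewrite det_pivot_congr ?gt_eqF // mulr_gt0.
Qed.

(** * The tangent inequality for the determinant *)

(** Hadamard's inequality.  The determinant is the pivot c times that of the
    Schur complement, whose diagonal entries d_ii - u_i^2 / c are at most d_ii;
    all products being positive, equality forces every u_i to vanish. *)
Lemma hadamard (R : realType) (m : nat) (A : 'M[R]_m) :
  posdef A -> \det A <= \prod_i A i i ?= iff is_diag_mx A.
Proof.
elim: m A => [|m IH] A pdA.
  rewrite det_mx00 big_ord0; apply/leifP.
  by have -> : is_diag_mx A by apply/is_diag_mxP => [[]].
move: A pdA; rewrite -[m.+1]/(1 + m)%N => A pdA.
have [c [u [d [defA c_gt0 pdS]]]] := posdef_schur pdA.
have pdd : posdef d by move: pdA; rewrite defA; apply: posdef_drsub.
have -> : \prod_i A i i = c * \prod_i d i i.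
  rewrite defA big_split_ord big_ord1 /= block_mxEul mxE mulr1n.
  by congr (_ * _); apply: eq_bigr => i _; rewrite block_mxEdr.
rewrite defA det_pivot_congr ?gt_eqF //.
have leS i : true -> schur c u d i i <= d i i ?= iff (u 0 i == 0).
  move=> _; rewrite !mxE big_ord1 mxE -expr2.
  apply/leifP; case: eqP => [->|/eqP u0]; first by rewrite expr0n mulr0 subr0.
  by rewrite gtrBl mulr_gt0 ?invr_gt0 ?exprn_even_gt0.
have S_ge0 i : true -> 0 <= schur c u d i i.
  by move=> _; apply/ltW/posdef_diag_gt0.
have := leif_trans (IH _ pdS) (leif_pprod S_ge0 leS).
have /gt_eqF -> : 0 < \prod_i d i i by apply: prodr_gt0 => i _; apply: posdef_diag_gt0.
rewrite /= -(mono_leif (ler_pM2l c_gt0)).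
rewrite is_diag_block_mx // trmx_eq0 andbA andbb scalar_mx_is_diag /=.
have -> : [forall i, u 0 i == 0] = (u == 0).
  apply/forallP/eqP => [u0|-> i]; last by rewrite mxE.
  by apply/rowP => i; rewrite (eqP (u0 i)) mxE.
rewrite andbC; case: eqP => //= ->.
by rewrite /schur mulmx0 scaler0 subr0.
Qed.

(** The tangent inequality at the identity.  Hadamard bounds the determinant
    by the product of the diagonal, and the mean inequality bounds the latter
    by a power of the mean mu of the diagonal, which is at most 1.  Equality
    throughout makes C diagonal, constant on the diagonal, and mu = 1. *)
Lemma det_le1 (R : realType) (m : nat) (C : 'M[R]_m) :
  posdef C -> \tr C <= m%:R -> \det C <= 1 ?= iff (C == 1%:M).
Proof.
case: m C => [|m] C pdC tr_le.
  (* The mean is undefined in order 0, where there is a single matrix. *)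
  by rewrite det_mx00 (flatmx0 C) (flatmx0 1%:M) eqxx; apply/leifP.
have C_ge0 : {in 'I_m.+1, forall i, 0 <= C i i}.
  by move=> i _; apply/ltW/posdef_diag_gt0.
set mu := \tr C / m.+1%:R.
have mu_ge0 : 0 <= mu by rewrite divr_ge0 // sumr_ge0 // => i _; apply: C_ge0.
have mu_le1 : mu <= 1 by rewrite ler_pdivrMr ?mul1r ?ltr0n.
have muX_le1 : mu ^+ m.+1 <= 1 by rewrite exprn_ile1.
have := leif_trans (hadamard pdC)
  (leif_trans (leif_AGM C_ge0) (leif_eq _)).
rewrite card_ord => /(_ _ muX_le1).
congr (_ <= _ ?= iff _); apply/and3P/eqP => [[/is_diag_mxP Cdiag Cconst]|->].
  rewrite pexpr_eq1 // => /eqP mu1; apply/matrixP => i j; rewrite mxE.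
  have [<-|] := eqVneq i j; last by move=> ij; rewrite Cdiag.
  have trC : \sum_(k in 'I_m.+1) C k k = C i i *+ m.+1.
    rewrite (eq_bigr (fun=> C i i)) ?sumr_const ?card_ord // => k _.
    by apply/eqP; have /forall_inP/(_ k isT)/forall_inP/(_ i isT) := Cconst.
  by move: mu1; rewrite trC -[C i i *+ _]mulr_natr mulfK ?pnatr_eq0 // => ->.
split; first exact: scalar_mx_is_diag.
  by apply/forall_inP => i _; apply/forall_inP => j _; rewrite !mxE !eqxx.
by rewrite -/(\tr (1%:M : 'M[R]_m.+1)) mxtrace1 divff ?pnatr_eq0 // expr1n.
Qed.

(** The tangent inequality at B.  The adjugate stands for B^-1, up to the
    positive factor det B.  If P^T B P is the identity then P P^T = B^-1, so
    the trace hypothesis says that C = P^T A P has trace at most m, while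
    det A = det B * det C. *)
Lemma det_leif (R : realType) (m : nat) (A B : 'M[R]_m) :
  posdef A -> posdef B -> \tr (\adj B *m (A - B)) <= 0 ->
  \det A <= \det B ?= iff (A == B).
Proof.
move=> pdA pdB tr_le0.
have [P uP defP] := posdef_diagonalize pdB.
have B_gt0 := posdef_det_gt0 pdB.
have uB : B \in unitmx by rewrite unitmxE unitfE gt_eqF.
have detBP : \det B * (\det P ^+ 2) = 1.
  by rewrite -(det1 _ m) -defP !det_mulmx det_tr; ring.
have PPt : P *m P^T = invmx B.
  have PtB : P^T *m B = invmx P by rewrite -[LHS](mulmxK uP) defP mul1mx.
  by rewrite -[LHS](mulmxK uB) -(mulmxA P) PtB mulmxV // mul1mx.
have trC : \tr (P^T *m A *m P) <= m%:R.
  rewrite mxtrace_mulC mulmxA PPt -(ler_pM2l B_gt0) -mxtraceZ.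
  rewrite scalemxAl; move: tr_le0; rewrite mulmxBr linearB /= mul_adj_mx.
  rewrite mxtrace_scalar /invmx uB scalerA divff ?gt_eqF // scale1r subr_le0.
  by rewrite mulr_natr.
have := det_le1 (posdef_congr pdA uP) trC.
rewrite -(mono_leif (ler_pM2l B_gt0)) mulr1.
have -> : \det B * \det (P^T *m A *m P) = \det A.
  by rewrite !det_mulmx det_tr -[RHS]mulr1 -detBP; ring.
congr (_ <= _ ?= iff _); rewrite -defP; apply/eqP/eqP => [|->//].
have uPt : P^T \in unitmx by rewrite unitmx_tr.
by move=> /(can_inj (mulmxK uP))/(can_inj (mulKmx uPt)).
Qed.

(** * Increasing the determinant by a small perturbation *)

Lemma poly_gt0_near0 (R : realType) (p : {poly R}) :
  0 < p.[0] -> exists2 t0, 0 < t0 & forall t, 0 <= t <= t0 -> 0 < p.[t].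
Proof.
move=> p0; have /factor_theorem[q defq] : root (p - p.[0]%:P) 0.
  by rewrite rootE !hornerE subrr.
have pE t : p.[t] = p.[0] + q.[t] * t.
  by rewrite -{1}(subrK p.[0]%:P p) defq !hornerE /=; ring.
have [K qK] := poly_disk_bound q 1.
have K_ge0 : 0 <= K by apply: le_trans (qK 0 _); rewrite ?normr0.
(* Write p = p(0) + t q; K bounds |q| on [0, 1], and K + 1 avoids dividing by 0. *)
exists (Num.min 1 (p.[0] / (K + 1))).
  by rewrite lt_min ltr01 divr_gt0 // ltr_wpDl.
move=> t /andP[t_ge0]; rewrite le_min => /andP[t1]; rewrite ler_pdivlMr; last lra.
move=> tK; have := qK t; rewrite ger0_norm // => /(_ t1).
rewrite ler_norml pE => /andP[qt _]; have [->|t_neq0] := eqVneq t 0; first lra.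
have t_gt0 : 0 < t by rewrite lt_neqAle eq_sym t_neq0.
nra.
Qed.

(** Since |v_i v_j| <= |v|^2, the quadratic form of F is bounded below by
    - (sum of the |F_ij|) |v|^2. *)
Lemma posdef_near1 (R : realType) (m : nat) (F : 'M[R]_m) (t : R) :
  F^T = F -> 0 <= t -> t * (\sum_i \sum_j `|F i j|) < 1 -> posdef (1%:M + t *: F).
Proof.
move=> symF t_ge0 tF; split; first by rewrite linearD linearZ /= symF trmx1.
move=> v v_neq0; set q := \sum_i v i 0 ^+ 2.
have sq_ge0 i : true -> 0 <= v i 0 ^+ 2 by rewrite sqr_ge0.
have q_gt0 : 0 < q.
  rewrite lt_neqAle sumr_ge0 // andbT eq_sym psumr_eq0 //.
  apply: contraNN v_neq0 => /allP v0; apply/eqP/colP => i.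
  by apply/eqP; rewrite mxE -sqrf_eq0; apply: v0; rewrite mem_index_enum.
have sq_le i : v i 0 ^+ 2 <= q.
  by rewrite /q (bigD1 i) //= lerDl; apply: sumr_ge0 => j _; apply: sq_ge0.
rewrite mulmxDr mulmx1 mulmxDl -scalemxAr -scalemxAl mxE [X in _ + X]mxE.
have -> : (v^T *m v) 0 0 = q by rewrite mxE; apply: eq_bigr => i _; rewrite mxE.
have : - (v^T *m F *m v) 0 0 <= (\sum_i \sum_j `|F i j|) * q.
  rewrite exchange_big /= mxE mulr_suml -sumrN; apply: ler_sum => j _.
  rewrite mxE !mulr_suml -sumrN; apply: ler_sum => i _; rewrite mxE.
  have [vi_le vj_le] := (sq_le i, sq_le j).
  have vv_le : `|v i 0 * v j 0| <= q.
    by rewrite ler_norml; apply/andP; split; nra.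
  apply: le_trans (ler_norm _) _.
  by rewrite normrN mulrAC mulrC normrM ler_wpM2l.
move: (_ 0 0) (\sum_i _) tF => x K tF xK; nra.
Qed.

(** Positive definiteness is an open condition.  Once a congruence has turned
    B into the identity, the entrywise bound above gives an explicit radius. *)
Lemma posdef_near (R : realType) (m : nat) (B E : 'M[R]_m) :
  posdef B -> E^T = E ->
  exists2 t0, 0 < t0 & forall t, 0 <= t <= t0 -> posdef (B + t *: E).
Proof.
move=> pdB symE; have [P uP defP] := posdef_diagonalize pdB.
pose F := P^T *m E *m P; pose K := \sum_i \sum_j `|F i j|.
have K_ge0 : 0 <= K by apply: sumr_ge0 => i _; apply: sumr_ge0.
exists (K + 1)^-1; first by rewrite invr_gt0 ltr_wpDl.
move=> t /andP[t_ge0 t_le].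
have symF : F^T = F by rewrite !trmx_mul symE trmxK mulmxA.
have tK : t * K < 1.
  move: t_le; rewrite -[_^-1]mul1r ler_pdivlMr ?ltr_wpDl //.
  have [->|t_neq0] := eqVneq t 0; first by rewrite !mul0r ltr01.
  have t_gt0 : 0 < t by rewrite lt_def t_neq0.
  by rewrite mulrDr mulr1 => tK; apply: lt_le_trans tK; rewrite ltrDl.
have := posdef_congr (posdef_near1 symF t_ge0 tK) (_ : invmx P \in unitmx).
rewrite unitmx_inv => /(_ uP); congr posdef.
rewrite -defP /F scalemxAl scalemxAr -mulmxDl -mulmxDr trmx_inv.
by rewrite -(mulmxA P^T) mulKmx ?unitmx_tr // mulmxK.
Qed.

(** The derivative of the determinant at B in the direction E is
    tr (adj B E).  At A = B + t E the trace tr (adj A E) is a polynomial in t,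
    hence still positive for small t, and then
    tr (adj A (B - A)) = - t tr (adj A E) < 0, so that the tangent inequality
    based at A rather than B yields det B < det A. *)
Lemma det_increase (R : realType) (m : nat) (B E : 'M[R]_m) :
  posdef B -> E^T = E -> 0 < \tr (\adj B *m E) ->
  exists2 t, 0 < t & posdef (B + t *: E) /\ \det B < \det (B + t *: E).
Proof.
move=> pdB symE trBE.
pose p := \tr (\adj (map_mx polyC B + 'X *: map_mx polyC E) *m map_mx polyC E).
have pE t : p.[t] = \tr (\adj (B + t *: E) *m E).
  rewrite -[p.[t]]/(horner_eval t p) /p -trace_map_mx map_mxM map_mx_adj.
  rewrite map_mxD map_mxZ -!map_mx_comp.
  have evC (A : 'M[R]_m) : map_mx (horner_eval t \o polyC) A = A.
    by apply/matrixP => i j; rewrite mxE /= /horner_eval hornerC.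
  by rewrite !evC /= /horner_eval hornerX.
have [|t1 t1_gt0 t1P] := poly_gt0_near0 (p := p).
  by rewrite pE scale0r addr0.
have [t2 t2_gt0 t2P] := posdef_near pdB symE.
pose t := Num.min t1 t2.
have t_gt0 : 0 < t by rewrite lt_min t1_gt0.
have pdt : posdef (B + t *: E) by apply: t2P; rewrite ltW //= ge_min lexx orbT.
have trt : 0 < \tr (\adj (B + t *: E) *m E).
  by rewrite -pE t1P // ltW //= ge_min lexx.
exists t => //; split=> //.
have tr_le0 : \tr (\adj (B + t *: E) *m (B - (B + t *: E))) <= 0.
  by rewrite opprD addNKr mulmxN -scalemxAr linearN linearZ /= oppr_le0 mulr_ge0 ?ltW.
rewrite (lt_leif (det_leif pdB pdt tr_le0)).
apply: contraTneq trt => /eqP; rewrite -subr_eq0 opprD addNKr oppr_eq0 scaler_eq0.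
by rewrite gt_eqF //= => /eqP->; rewrite mulmx0 linear0 ltxx.
Qed.

(** * Toeplitz matrices and deleted minors *)

Lemma even_seq_abs (R : realType) (e : int -> R) (x : int) :
  even_seq e -> e `|x|%N%:Z = e x.
Proof.
move=> e_even; have [x_ge0|x_lt0] := leP 0 x; first by rewrite gez0_abs.
by rewrite ltz0_abs // e_even.
Qed.

(** The cofactor sign (-1)^(r+s) equals (-1)^|r-s|, and an even e takes the
    value e_|r-s| at r - s: both are constant on the pairs with |r - s| = k,
    over which the cofactors add up to (-1)^k S_k. *)
Lemma tr_adj_toeplitz (R : realType) (n : nat) (M : 'M[R]_n.+1) (e : int -> R) :
  even_seq e ->
  \tr (\adj M *m toeplitz n e) =
  \sum_(k < n.+1) (-1) ^+ k * e k%:Z * deleted_minor_sum M k.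
Proof.
move=> e_even.
pose dist (r s : 'I_n.+1) : 'I_n.+1 := inord `|r%:Z - s%:Z|%N.
have distE r s : dist r s = `|r%:Z - s%:Z|%N :> nat.
  by rewrite inordK //; have := ltn_ord r; have := ltn_ord s; lia.
transitivity (\sum_(r < n.+1) \sum_(s < n.+1) cofactor M r s * e (r%:Z - s%:Z)).
  rewrite mxtrace_mulC /mxtrace; apply: eq_bigr => r _; rewrite mxE.
  by apply: eq_bigr => s _; rewrite !mxE mulrC.
under eq_bigr => r _ do rewrite (partition_big (dist r) predT) //=.
rewrite exchange_big /=; apply: eq_bigr => k _.
rewrite /deleted_minor_sum mulr_sumr; apply: eq_bigr => r _.
rewrite mulr_sumr; apply: eq_big => s; first by rewrite -val_eqE /= distE.
move=> /eqP defk; have := distE r s; rewrite defk => ->.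
rewrite -(even_seq_abs _ e_even).
rewrite /cofactor /deleted_minor -(signr_odd _ (r + s)) -(signr_odd _ `|_|).
have -> : odd `|r%:Z - s%:Z| = odd (r + s) by lia.
by rewrite mulrAC.
Qed.

Lemma toeplitzB (R : realType) (n : nat) (a b : int -> R) :
  toeplitz n a - toeplitz n b = toeplitz n (fun j => a j - b j).
Proof. by apply/matrixP => r s; rewrite !mxE. Qed.

Lemma tr_toeplitz (R : realType) (n : nat) (e : int -> R) :
  even_seq e -> (toeplitz n e)^T = toeplitz n e.
Proof. by move=> e_even; apply/matrixP => r s; rewrite !mxE -opprB e_even. Qed.

(** The trace that governs the tangent inequality is, up to sign, the sum over
    k of (-1)^k (b_k - a_k) S_k(B), a sum of products of nonnegative numbers. *)
Lemma det_toeplitz_leif (R : realType) (n : nat) (a b : int -> R) :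
  even_seq a -> even_seq b -> posdef (toeplitz n a) -> posdef (toeplitz n b) ->
  (forall k : nat, (k <= n)%N -> 0 <= deleted_minor_sum (toeplitz n b) k) ->
  alternating_le n a b ->
  \det (toeplitz n a) <= \det (toeplitz n b)
    ?= iff (toeplitz n a == toeplitz n b).
Proof.
move=> a_even b_even pda pdb S_ge0 ab; apply: det_leif => //.
rewrite toeplitzB tr_adj_toeplitz => [|j]; last by rewrite a_even b_even.
rewrite -oppr_ge0 -sumrN; apply: sumr_ge0 => k _; rewrite -mulNr -mulrN opprB.
by rewrite mulr_ge0 ?ab ?S_ge0 // -ltnS.
Qed.

(** The diagonal minors are det B times the diagonal entries of B^-1, which is
    positive definite, being congruent to B through B^-1. *)
Lemma deleted_minor_sum0_gt0 (R : realType) (n : nat) (B : 'M[R]_n.+1) :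
  posdef B -> 0 < deleted_minor_sum B 0.
Proof.
move=> pdB; have B_gt0 := posdef_det_gt0 pdB.
have uB : B \in unitmx by rewrite unitmxE unitfE gt_eqF.
have pdV : posdef (invmx B).
  have : posdef ((invmx B)^T *m B *m invmx B) by apply: posdef_congr; rewrite ?unitmx_inv.
  by rewrite -mulmxA mulmxV // mulmx1 trmx_inv pdB.1.
have minor_gt0 r : 0 < deleted_minor B r r.
  have := posdef_diag_gt0 r pdV.
  rewrite /invmx uB !mxE pmulr_rgt0 ?invr_gt0 //.
  by rewrite /cofactor addnn -signr_odd odd_double mul1r.
rewrite /deleted_minor_sum (eq_bigr (fun r => deleted_minor B r r)) => [|r _].
  by rewrite big_ord_recl ltr_pwDl // sumr_ge0 // => i _; rewrite ltW.
by apply: big_pred1 => s; rewrite absz_eq0 subr_eq0 eqz_nat eq_sym.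
Qed.

Lemma totally_nonneg_minor (R : realType) (m : nat) (B : 'M[R]_m.+1) r s :
  totally_nonneg B -> 0 <= deleted_minor B r s.
Proof.
move=> tnB; rewrite /deleted_minor.
have -> : row' r (col' s B) = mxsub (lift r) (lift s) B by apply/matrixP => i j; rewrite !mxE.
by apply: tnB => i j; rewrite /= /bump; lia.
Qed.

Theorem theorem2p1 (R : realType) (n : nat) (hn : (1 <= n)%N) (b : int -> R)
    (b_even : even_seq b) (b_posdef : posdef (toeplitz n b)) :
  let B := toeplitz n b in
  let cond_i := forall k : nat, (k <= n)%N -> 0 <= deleted_minor_sum B k in
  let cond_ii := forall a : int -> R,
    even_seq a -> posdef (toeplitz n a) -> alternating_le n a b ->
    \det (toeplitz n a) <= \det B in
  [/\ cond_i <-> cond_ii,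
      cond_i -> forall a : int -> R,
        even_seq a -> posdef (toeplitz n a) -> alternating_le n a b ->
        (\det (toeplitz n a) = \det B <-> toeplitz n a = B),
      0 < deleted_minor_sum B 0,
      (forall r s : 'I_n.+1, 0 <= deleted_minor B r s) -> cond_i &
      totally_nonneg B -> cond_i].
Proof.
move=> B cond_i cond_ii.
have minors_i : (forall r s : 'I_n.+1, 0 <= deleted_minor B r s) -> cond_i.
  by move=> minor_ge0 k _; do 2!apply: sumr_ge0 => ? _.
split=> //; last 2 first.
- exact: deleted_minor_sum0_gt0.
- by move=> tnB; apply: minors_i => r s; apply: totally_nonneg_minor.
- split=> [S_ge0 a a_even pda ab|max_det k le_kn].
    exact: (det_toeplitz_leif a_even b_even pda b_posdef S_ge0 ab).1.
  rewrite leNgt; apply/negP => Sk_lt0.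
  (* Move only the diagonals |j| = k; for a = b + t e this sign of e makes
     (-1)^k (b_k - a_k) = t > 0, and tr (adj B (toeplitz e)) = - S_k > 0. *)
  pose e (j : int) : R := - ((-1) ^+ k *+ (`|j|%N == k)).
  have e_even : even_seq e by move=> j; rewrite /e abszN.
  have [||t t_gt0 [pdt]] := det_increase (E := toeplitz n e) b_posdef.
  + exact: tr_toeplitz.
  + rewrite tr_adj_toeplitz // (bigD1 (Ordinal (le_kn : k < n.+1)%N)) //= big1.
      by rewrite /e absz_nat eqxx mulr1n mulrN -expr2 sqrr_sign mulN1r addr0 oppr_gt0.
    by move=> i; rewrite -val_eqE /e /= => /negPf->; rewrite mulr0n oppr0 mulr0 mul0r.
  have defA : B + t *: toeplitz n e = toeplitz n (fun j => b j + t * e j).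
    by apply/matrixP => r s; rewrite !mxE.
  rewrite defA in pdt *; apply/negP; rewrite -leNgt; apply: max_det => //.
    by move=> j; rewrite b_even e_even.
  move=> j _; rewrite opprD addNKr /e absz_nat; case: eqP => [->|_].
    by rewrite mulr1n !mulrN opprK mulrCA -expr2 sqrr_sign mulr1 ltW.
  by rewrite mulr0n oppr0 mulr0 oppr0 mulr0.
- move=> S_ge0 a a_even pda ab.
  have /eq_leif E := det_toeplitz_leif a_even b_even pda b_posdef S_ge0 ab.
  by split=> [/eqP|-> //]; rewrite E => /eqP.
Qed.
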